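(* The time complexity of the dynamic programming procedure DynProg described in the context is $O(n^2)$, and the time complexity of the procedure BuildSolution described in the context (which reconstructs a speed profile from the predecessor map) is $O(n)$.
   Context: Complexity counts elementary operations in the real-arithmetic model (arithmetic, comparisons and evaluation of square roots and trigonometric functions cost $O(1)$). Data: $n\ge3$; $h,M,P_{\max},g,\mu,\gamma>0$, $c\ge0$, $\lambda>0$, $\eta\in(0,1]$; $\alpha_1,\dots,\alpha_{n-1}\in(-\pi/2,\pi/2)$; vectors $y\le z$ in $\mathbb{R}^n$ with $y_1=z_1=w_{\rm in}$, $y_n=z_n=w_{\rm fin}$; two reference values $w^+,w^->0$. For consecutive values $w_j,w_{j+1}$ the force is $f_j=\frac1h(w_{j+1}-w_j)+\gamma w_j+g(\sin\alpha_j+c\cos\alpha_j)$. Let $W_j=\{y_j,z_j,w^+,w^-\}$; states are pairs $(j,w_j)$ with $j\in\{1,\dots,n\}$, $w_j\in W_j$. For a value $w$ at step $j$, $\Gamma_j(w)$ is the set of $w_{j+1}\in[y_{j+1},z_{j+1}]$ for which $-g\mu\cos\alpha_j\le f_j\le\min\{g\mu\cos\alpha_j,\frac{P_{\max}}{M\sqrt{2w}}\}$ (with $w_j=w$). Single-step moves from $(j,w_j)$: to all $(j+1,w_{j+1})$ with $w_{j+1}\in W_{j+1}\cap\Gamma_j(w_j)$. Null-force moves from $(j,w_j)$: let $w^{j,0}_j=w_j$, $w^{j,0}_{j+i}=(1-h\gamma)w^{j,0}_{j+i-1}-hg(\sin\alpha_{j+i-1}+c\cos\alpha_{j+i-1})$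 (the curve with zero force); let $N$ be the largest $i\le n-j-1$ such that the curve stays in $[y_{j+r},z_{j+r}]$ for all $0\le r\le i$; the moves lead to all $(j+i+1,v)$ with $1\le i\le N$ and $v\in W_{j+i+1}\cap\Gamma_{j+i}(w^{j,0}_{j+i})$. The cost of a move from step $j$ to step $j+i$ along intermediate speeds $w_j,\dots,w_{j+i}$ is $\sum_{r=0}^{i-1}\big(\lambda M\eta\gamma w_{j+r}+\frac1{\sqrt{2w_{j+r}}}\big)+(1-\eta)\lambda M\max\{f_{j+i-1},0\}$. DynProg: start with a queue containing only $(1,w_{\rm in})$, with value $V(1,w_{\rm in})=0$. While the queue is nonempty, extract a state with lowest step index, and for each state reachable from it by a single-step or null-force move, compute the candidate value (value of the extracted state plus move cost); if the target state is not in the queue, insert it with this value and record the extracted state as its predecessor $P$; otherwise, if the candidate is smaller than the current value, update value and predecessor. Return $V(n,w_{\rm fin})$ and $P$. BuildSolution: starting from $(n,w_{\rm fin})$, repeatedly pass from the current state $(j,\bar w)$ to its predecessor $P(j,\bar w)=(j-r,w_{j-r})$, setting $w^\star_{j-r}=w_{j-r}$ and, if $r>1$, filling $w^\star_{j-r+1},\dots,w^\star_{j-1}$ along the null-force curve started at $w_{j-r}$; stop when step $1$ is reached and return $w^\star$. *)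

(* Defs.v *)
From Stdlib Require Import String.
From mathcomp Require Import all_boot all_order all_algebra.
From mathcomp Require Import reals trigo.

Set Implicit Arguments.
Unset Strict Implicit.
Unset Printing Implicit Defensive.

Import Order.TTheory GRing.Theory Num.Theory.

(** * Real-RAM model

    Programs are closed syntax trees: they depend neither on [n] nor on the
    data, which they find in memory.  A memory has scalar variables and arrays
    of two sorts: natural numbers (indices) and real numbers.  Every node of an
    expression, every assignment and every test of a branch or of a loop costs
    one elementary operation. *)

Inductive iexp : Type :=
| ILit of nat
| IVar of string
| IAt of string & iexp
| IAdd of iexp & iexp
| ISub of iexp & iexp
| IMul of iexp & iexp
| IDiv of iexp & iexp
| IMod of iexp & iexp.

Inductive rexp : Type :=
| RLit of nat
| RVar of string
| RAt of string & iexp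
| RAdd of rexp & rexp
| RSub of rexp & rexp
| RMul of rexp & rexp
| RDiv of rexp & rexp
| ROpp of rexp
| RMin of rexp & rexp
| RMax of rexp & rexp
| RSqrt of rexp
| RSin of rexp
| RCos of rexp.

Inductive bexp : Type :=
| ILt of iexp & iexp
| ILe of iexp & iexp
| IEq of iexp & iexp
| RLt of rexp & rexp
| RLe of rexp & rexp
| REq of rexp & rexp
| BNot of bexp
| BAnd of bexp & bexp.

Inductive cmd : Type :=
| Skip
| ISet of string & iexp
| RSet of string & rexp
| ISetAt of string & iexp & iexp   (* array, index, value *)
| RSetAt of string & iexp & rexp
| Seq of cmd & cmd
| If of bexp & cmd & cmd
| While of bexp & cmd.

Declare Scope iexp_scope.
Delimit Scope iexp_scope with ie.
Bind Scope iexp_scope with iexp.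
Declare Scope rexp_scope.
Delimit Scope rexp_scope with re.
Bind Scope rexp_scope with rexp.
Declare Scope bexp_scope.
Delimit Scope bexp_scope with be.
Bind Scope bexp_scope with bexp.
Declare Scope cmd_scope.
Delimit Scope cmd_scope with cmd.
Bind Scope cmd_scope with cmd.

Arguments IVar _%_string.
Arguments IAt _%_string _%_ie.
Arguments IAdd (_ _)%_ie.
Arguments ISub (_ _)%_ie.
Arguments IMul (_ _)%_ie.
Arguments IDiv (_ _)%_ie.
Arguments IMod (_ _)%_ie.
Arguments RVar _%_string.
Arguments RAt _%_string _%_ie.
Arguments RAdd (_ _)%_re.
Arguments RSub (_ _)%_re.
Arguments RMul (_ _)%_re.
Arguments RDiv (_ _)%_re.
Arguments ROpp _%_re.
Arguments RMin (_ _)%_re.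
Arguments RMax (_ _)%_re.
Arguments RSqrt _%_re.
Arguments RSin _%_re.
Arguments RCos _%_re.
Arguments ILt (_ _)%_ie.
Arguments ILe (_ _)%_ie.
Arguments IEq (_ _)%_ie.
Arguments RLt (_ _)%_re.
Arguments RLe (_ _)%_re.
Arguments REq (_ _)%_re.
Arguments BNot _%_be.
Arguments BAnd (_ _)%_be.
Arguments ISet _%_string _%_ie.
Arguments RSet _%_string _%_re.
Arguments ISetAt _%_string (_ _)%_ie.
Arguments RSetAt _%_string _%_ie _%_re.
Arguments Seq (_ _)%_cmd.
Arguments If _%_be (_ _)%_cmd.
Arguments While _%_be _%_cmd.

Fixpoint icost (e : iexp) : nat :=
  match e with
  | ILit _ | IVar _ => 1
  | IAt _ i => (icost i).+1
  | IAdd a b | ISub a b | IMul a b | IDiv a b | IMod a b =>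
      (icost a + icost b).+1
  end.

Fixpoint rcost (e : rexp) : nat :=
  match e with
  | RLit _ | RVar _ => 1
  | RAt _ i => (icost i).+1
  | RAdd a b | RSub a b | RMul a b | RDiv a b | RMin a b | RMax a b =>
      (rcost a + rcost b).+1
  | ROpp a | RSqrt a | RSin a | RCos a => (rcost a).+1
  end.

Fixpoint bcost (e : bexp) : nat :=
  match e with
  | ILt a b | ILe a b | IEq a b => (icost a + icost b).+1
  | RLt a b | RLe a b | REq a b => (rcost a + rcost b).+1
  | BNot a => (bcost a).+1
  | BAnd a b => (bcost a + bcost b).+1
  end.

Record memory (R : Type) := Memory {
  ivar : string -> nat;
  rvar : string -> R;
  iarr : string -> nat -> nat;
  rarr : string -> nat -> R
}.

Definition upd (A : Type) (f : string -> A) (x : string) (v : A) : string -> A :=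
  fun x' => if String.eqb x' x then v else f x'.

Definition upd_at (A : Type) (f : string -> nat -> A) (a : string) (i : nat)
    (v : A) : string -> nat -> A :=
  fun a' i' => if String.eqb a' a && (i' == i) then v else f a' i'.

Section Semantics.
Variable R : realType.
Implicit Types s : memory R.

Fixpoint ieval s (e : iexp) : nat :=
  match e with
  | ILit k => k
  | IVar x => ivar s x
  | IAt a i => iarr s a (ieval s i)
  | IAdd a b => ieval s a + ieval s b
  | ISub a b => ieval s a - ieval s b
  | IMul a b => ieval s a * ieval s b
  | IDiv a b => ieval s a %/ ieval s b
  | IMod a b => ieval s a %% ieval s b
  end.

Fixpoint reval s (e : rexp) : R :=
  match e with
  | RLit k => k%:R%R
  | RVar x => rvar s x
  | RAt a i => rarr s a (ieval s i)
  | RAdd a b => (reval s a + reval s b)%R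
  | RSub a b => (reval s a - reval s b)%R
  | RMul a b => (reval s a * reval s b)%R
  | RDiv a b => (reval s a / reval s b)%R
  | ROpp a => (- reval s a)%R
  | RMin a b => Num.min (reval s a) (reval s b)
  | RMax a b => Num.max (reval s a) (reval s b)
  | RSqrt a => Num.sqrt (reval s a)
  | RSin a => sin (reval s a)
  | RCos a => cos (reval s a)
  end.

Fixpoint beval s (e : bexp) : bool :=
  match e with
  | ILt a b => ieval s a < ieval s b
  | ILe a b => ieval s a <= ieval s b
  | IEq a b => ieval s a == ieval s b
  | RLt a b => (reval s a < reval s b)%R
  | RLe a b => (reval s a <= reval s b)%R
  | REq a b => (reval s a == reval s b)%R
  | BNot a => ~~ beval s a
  | BAnd a b => beval s a && beval s b
  end.

Definition set_ivar s x v :=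
  Memory (upd (ivar s) x v) (rvar s) (iarr s) (rarr s).
Definition set_rvar s x v :=
  Memory (ivar s) (upd (rvar s) x v) (iarr s) (rarr s).
Definition set_iarr s a i v :=
  Memory (ivar s) (rvar s) (upd_at (iarr s) a i v) (rarr s).
Definition set_rarr s a i v :=
  Memory (ivar s) (rvar s) (iarr s) (upd_at (rarr s) a i v).

(* [exec c s t s']: started in [s], [c] halts in [s'] after [t] elementary
   operations.  A diverging run is related to no [t] and [s']. *)
Inductive exec : cmd -> memory R -> nat -> memory R -> Prop :=
| ExecSkip s : exec Skip s 1 s
| ExecISet x e s : exec (ISet x e) s (icost e).+1 (set_ivar s x (ieval s e))
| ExecRSet x e s : exec (RSet x e) s (rcost e).+1 (set_rvar s x (reval s e))
| ExecISetAt a i e s :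
    exec (ISetAt a i e) s (icost i + icost e).+1
         (set_iarr s a (ieval s i) (ieval s e))
| ExecRSetAt a i e s :
    exec (RSetAt a i e) s (icost i + rcost e).+1
         (set_rarr s a (ieval s i) (reval s e))
| ExecSeq c1 c2 s s1 s2 t1 t2 :
    exec c1 s t1 s1 -> exec c2 s1 t2 s2 -> exec (Seq c1 c2) s (t1 + t2) s2
| ExecIfT b c1 c2 s s' t :
    beval s b -> exec c1 s t s' -> exec (If b c1 c2) s ((bcost b).+1 + t) s'
| ExecIfF b c1 c2 s s' t :
    ~~ beval s b -> exec c2 s t s' -> exec (If b c1 c2) s ((bcost b).+1 + t) s'
| ExecWhileT b c s s1 s2 t1 t2 :
    beval s b -> exec c s t1 s1 -> exec (While b c) s1 t2 s2 ->
    exec (While b c) s ((bcost b).+1 + t1 + t2) s2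
| ExecWhileF b c s :
    ~~ beval s b -> exec (While b c) s (bcost b).+1 s.

Definition halts_within (c : cmd) (s : memory R) (T : nat) : Prop :=
  exists (t : nat) (s' : memory R), exec c s t s' /\ t <= T.

(* Runs are deterministic, so [halts_within] bounds the only run. *)
Lemma exec_det c s t1 t2 s1 s2 :
  exec c s t1 s1 -> exec c s t2 s2 -> t1 = t2 /\ s1 = s2.
Proof.
move=> H; elim: H t2 s2 => {c s t1 s1}; intros;
  match goal with H : exec _ _ _ _ |- _ => inversion H; subst end;
  repeat match goal with
  | IH : forall t s', exec ?c ?s t s' -> _, H : exec ?c ?s _ _ |- _ =>
      case: (IH _ _ H) => ? ?; subst; clear IH H
  | H : is_true (~~ ?b), H' : is_true ?b |- _ => by rewrite H' in H
  end; by [].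
Qed.

End Semantics.

(** * The two procedures *)

Coercion ILit : nat >-> iexp.
Coercion IVar : string >-> iexp.
Coercion RLit : nat >-> rexp.
Coercion RVar : string >-> rexp.

Notation "a + b" := (IAdd a b) : iexp_scope.
Notation "a - b" := (ISub a b) : iexp_scope.
Notation "a * b" := (IMul a b) : iexp_scope.
Notation "a / b" := (IDiv a b) : iexp_scope.
Notation "a + b" := (RAdd a b) : rexp_scope.
Notation "a - b" := (RSub a b) : rexp_scope.
Notation "a * b" := (RMul a b) : rexp_scope.
Notation "a / b" := (RDiv a b) : rexp_scope.
Notation "- a" := (ROpp a) : rexp_scope.
Notation "~~ a" := (BNot a) : bexp_scope.
Notation "a && b" := (BAnd a b) : bexp_scope.
Notation "c1 ;; c2" := (Seq c1 c2)
  (at level 90, right associativity) : cmd_scope.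

Section Programs.
Local Open Scope string_scope.
Local Open Scope nat_scope.

(* Steps are numbered from 1 to n.  The set W_j is stored in the four slots
   "W"[4j], .., "W"[4j+3] as y_j, z_j, w^+, w^-.  Since these values may
   coincide, the state (j, w) is encoded by the number 4j+k of the *first* slot
   of step j that contains w; so (1, w_in) is 4 and (n, w_fin) is 4n. *)

(* The force f_j between the speeds w_j = u and w_{j+1} = v. *)
Definition force (j : iexp) (u v : rexp) : rexp :=
  1 / "h" * (v - u) + "gamma" * u
  + "g" * (RSin (RAt "alpha" j) + "c" * RCos (RAt "alpha" j)).

(* v \in Gamma_j(u), given the force f between u and v. *)
Definition in_Gamma (j : iexp) (u v f : rexp) : bexp :=
  RLe (RAt "y" (j + 1)) v && RLe v (RAt "z" (j + 1))
  && RLe (- ("g" * "mu" * RCos (RAt "alpha" j))) f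
  && RLe f (RMin ("g" * "mu" * RCos (RAt "alpha" j))
                 ("Pmax" / ("M" * RSqrt (2 * u)))).

(* The value at step j+1 of the zero-force curve with value u at step j. *)
Definition null_step (j : iexp) (u : rexp) : rexp :=
  (1 - "h" * "gamma") * u
  - "h" * "g" * (RSin (RAt "alpha" j) + "c" * RCos (RAt "alpha" j)).

(* The summand of the move cost contributed by the speed u. *)
Definition speed_cost (u : rexp) : rexp :=
  "lambda" * "M" * "eta" * "gamma" * u + 1 / RSqrt (2 * u).

(* The summand of the move cost contributed by the last force f. *)
Definition force_cost (f : rexp) : rexp :=
  (1 - "eta") * "lambda" * "M" * RMax f 0.

(* Table W, empty queue, empty predecessor map (0 means undefined), and then
   insertion of (1, w_in) with value 0. *)
Definition Initialize : cmd :=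
  ISet "j" 1 ;;
  While (ILe "j" "n")
    (RSetAt "W" (4 * "j") (RAt "y" "j") ;;
     RSetAt "W" (4 * "j" + 1) (RAt "z" "j") ;;
     RSetAt "W" (4 * "j" + 2) "wplus" ;;
     RSetAt "W" (4 * "j" + 3) "wminus" ;;
     ISet "k" 0 ;;
     While (ILt "k" 4)
       (ISetAt "Q" (4 * "j" + "k") 0 ;;
        ISetAt "P" (4 * "j" + "k") 0 ;;
        ISet "k" ("k" + 1)) ;;
     ISet "j" ("j" + 1)) ;;
  ISetAt "Q" 4 1 ;;
  RSetAt "V" 4 0.

(* The queue is the set of the states p with "Q"[p] = 1.  This search leaves
   in "p" a queued state with lowest step, or 4n+4 if the queue is empty. *)
Definition FindLowest : cmd :=
  ISet "p" 4 ;;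
  While (ILt "p" (4 * "n" + 4) && IEq (IAt "Q" "p") 0)
    (ISet "p" ("p" + 1)).

(* Moves out of the extracted state "p" whose last force is applied at step
   "m", where the speed is "u"; "acc" is the value of "p" plus the sum of the
   speed costs up to step "m".  The targets are the v in the set
   W_{m+1} \cap Gamma_m(u), a v occurring in several slots being processed for
   its first slot only. *)
Definition Expand : cmd :=
  ISet "k" 0 ;;
  While (ILt "k" 4)
    (ISet "q" (4 * ("m" + 1) + "k") ;;
     RSet "v" (RAt "W" "q") ;;
     ISet "l" 0 ;;
     While (~~ REq (RAt "W" (4 * ("m" + 1) + "l")) "v")
       (ISet "l" ("l" + 1)) ;;
     RSet "f" (force "m" "u" "v") ;;
     If (IEq "l" "k" && in_Gamma "m" "u" "v" "f")
       (RSet "cand" ("acc" + force_cost "f") ;;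
        If (IEq (IAt "Q" "q") 0)
          (ISetAt "Q" "q" 1 ;;
           RSetAt "V" "q" "cand" ;;
           ISetAt "P" "q" "p")
          (If (RLt "cand" (RAt "V" "q"))
             (RSetAt "V" "q" "cand" ;;
              ISetAt "P" "q" "p")
             Skip))
       Skip ;;
     ISet "k" ("k" + 1)).

Definition SingleStepMoves : cmd :=
  If (ILt "j" "n")
    (ISet "m" "j" ;;
     RSet "u" "w" ;;
     RSet "acc" (RAt "V" "p" + speed_cost "u") ;;
     Expand)
    Skip.

(* When the loop is entered with "i" = i, "u" is the i-th point of the curve;
   the loop body is thus executed exactly for i = 0, .., N. *)
Definition NullForceMoves : cmd :=
  ISet "i" 0 ;;
  ISet "m" "j" ;;
  RSet "u" "w" ;;
  RSet "acc" (RAt "V" "p" + speed_cost "u") ;;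
  While (ILe ("m" + 1) "n"
         && (RLe (RAt "y" "m") "u" && RLe "u" (RAt "z" "m")))
    (If (ILe 1 "i") Expand Skip ;;
     RSet "u" (null_step "m" "u") ;;
     RSet "acc" ("acc" + speed_cost "u") ;;
     ISet "i" ("i" + 1) ;;
     ISet "m" ("m" + 1)).

(* The output is the variable "ret" (meaningful when (n, w_fin) has been
   reached, that is when "P"[4n] is not 0) and the array "P". *)
Definition DynProg : cmd :=
  Initialize ;;
  FindLowest ;;
  While (ILt "p" (4 * "n" + 4))
    (ISetAt "Q" "p" 0 ;;
     ISet "j" ("p" / 4) ;;
     RSet "w" (RAt "W" "p") ;;
     SingleStepMoves ;;
     NullForceMoves ;;
     FindLowest) ;;
  RSet "ret" (RAt "V" (4 * "n")).

(* "p" is the current state and "j" its step, "b" the predecessor of "p" and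
   "i" its step.  The inner loop does nothing when i = j-1. *)
Definition BuildSolution : cmd :=
  ISet "p" (4 * "n") ;;
  ISet "j" "n" ;;
  RSetAt "wstar" "j" (RAt "W" "p") ;;
  While (ILt 1 "j")
    (ISet "b" (IAt "P" "p") ;;
     ISet "i" ("b" / 4) ;;
     RSet "u" (RAt "W" "b") ;;
     RSetAt "wstar" "i" "u" ;;
     ISet "m" "i" ;;
     While (ILt ("m" + 1) "j")
       (RSet "u" (null_step "m" "u") ;;
        ISet "m" ("m" + 1) ;;
        RSetAt "wstar" "m" "u") ;;
     ISet "p" "b" ;;
     ISet "j" "i").

End Programs.

(** * The data *)

(* The components of the vectors are numbered from 0 here. *)
Record problem (R : realType) (n : nat) := Problem {
  pb_h : R; pb_M : R; pb_Pmax : R; pb_g : R; pb_mu : R; pb_gamma : R;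
  pb_c : R; pb_lambda : R; pb_eta : R;
  pb_alpha : 'rV[R]_n.-1;
  pb_y : 'rV[R]_n; pb_z : 'rV[R]_n;
  pb_win : R; pb_wfin : R; pb_wplus : R; pb_wminus : R;
  pb_h_gt0 : (0 < pb_h)%R;
  pb_M_gt0 : (0 < pb_M)%R;
  pb_Pmax_gt0 : (0 < pb_Pmax)%R;
  pb_g_gt0 : (0 < pb_g)%R;
  pb_mu_gt0 : (0 < pb_mu)%R;
  pb_gamma_gt0 : (0 < pb_gamma)%R;
  pb_c_ge0 : (0 <= pb_c)%R;
  pb_lambda_gt0 : (0 < pb_lambda)%R;
  pb_eta_bounds : (0 < pb_eta <= 1)%R;
  pb_alpha_bounds : forall i, (- (pi / 2) < pb_alpha ord0 i < pi / 2)%R;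
  pb_y_le_z : forall i, (pb_y ord0 i <= pb_z ord0 i)%R;
  pb_first : forall i : 'I_n, i = 0 :> nat ->
    pb_y ord0 i = pb_win /\ pb_z ord0 i = pb_win;
  pb_last : forall i : 'I_n, i = n.-1 :> nat ->
    pb_y ord0 i = pb_wfin /\ pb_z ord0 i = pb_wfin;
  pb_wplus_gt0 : (0 < pb_wplus)%R;
  pb_wminus_gt0 : (0 < pb_wminus)%R
}.

(* The memory contains the data; nothing is assumed of the other cells. *)
Record loaded (R : realType) (n : nat) (D : problem R n) (s : memory R) : Prop :=
  Loaded {
  ld_n : ivar s "n" = n;
  ld_h : rvar s "h" = pb_h D;
  ld_M : rvar s "M" = pb_M D;
  ld_Pmax : rvar s "Pmax" = pb_Pmax D;
  ld_g : rvar s "g" = pb_g D;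
  ld_mu : rvar s "mu" = pb_mu D;
  ld_gamma : rvar s "gamma" = pb_gamma D;
  ld_c : rvar s "c" = pb_c D;
  ld_lambda : rvar s "lambda" = pb_lambda D;
  ld_eta : rvar s "eta" = pb_eta D;
  ld_wplus : rvar s "wplus" = pb_wplus D;
  ld_wminus : rvar s "wminus" = pb_wminus D;
  ld_alpha : forall i : 'I_n.-1, rarr s "alpha" i.+1 = pb_alpha D ord0 i;
  ld_y : forall i : 'I_n, rarr s "y" i.+1 = pb_y D ord0 i;
  ld_z : forall i : 'I_n, rarr s "z" i.+1 = pb_z D ord0 i
}.

(* Main.v *)
(* A state is only ever reached from a state of a lower step.  Hence the states
   are extracted in increasing order, each of the 4n states at most once, and an
   extraction costs O(n): one scan of the queue and at most n points of the
   null-force curve, each with at most 4 targets.  For the same reason every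
   predecessor has a lower step, so the inner loop of BuildSolution runs at most
   n times in total. *)
From Stdlib Require Import String.
Require Import Defs.
From mathcomp Require Import all_boot all_order all_algebra.
From mathcomp Require Import reals.
From mathcomp Require Import zify.

Set Implicit Arguments.
Unset Strict Implicit.
Unset Printing Implicit Defensive.

(** * Total-correctness rules that track running time *)

Section Runs.
Variable R : realType.
Implicit Types (s : memory R) (Q : nat -> memory R -> Prop).

(** Halting is part of the claim, and the postcondition sees the time as well as the final memory.
    As runs are deterministic, one run says everything. *)
Definition wp (c : cmd) s Q : Prop := exists t s', exec c s t s' /\ Q t s'.

Lemma wp_mono c s Q Q' :
  wp c s Q -> (forall t s', Q t s' -> Q' t s') -> wp c s Q'.
Proof. by move=> [t [s' [? ?]]] QQ'; exists t, s'; split; last exact: QQ'. Qed.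

Lemma wp_skip s Q : Q 1 s -> wp Skip s Q.
Proof. by move=> ?; exists 1, s; split=> //; constructor. Qed.

Lemma wp_iset x e s Q :
  Q (icost e).+1 (set_ivar s x (ieval s e)) -> wp (ISet x e) s Q.
Proof. by move=> ?; do 2!eexists; split; [constructor|]. Qed.

Lemma wp_rset x e s Q :
  Q (rcost e).+1 (set_rvar s x (reval s e)) -> wp (RSet x e) s Q.
Proof. by move=> ?; do 2!eexists; split; [constructor|]. Qed.

Lemma wp_isetat a i e s Q :
  Q (icost i + icost e).+1 (set_iarr s a (ieval s i) (ieval s e)) ->
  wp (ISetAt a i e) s Q.
Proof. by move=> ?; do 2!eexists; split; [constructor|]. Qed.

Lemma wp_rsetat a i e s Q :
  Q (icost i + rcost e).+1 (set_rarr s a (ieval s i) (reval s e)) ->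
  wp (RSetAt a i e) s Q.
Proof. by move=> ?; do 2!eexists; split; [constructor|]. Qed.

Lemma wp_seq c1 c2 s Q :
  wp c1 s (fun t1 s1 => wp c2 s1 (fun t2 s2 => Q (t1 + t2) s2)) ->
  wp (Seq c1 c2) s Q.
Proof.
move=> [t1 [s1 [e1 [t2 [s2 [e2 ?]]]]]].
by exists (t1 + t2), s2; split=> //; apply: ExecSeq e1 e2.
Qed.

Lemma wp_if b c1 c2 s Q :
  (beval s b -> wp c1 s (fun t => Q ((bcost b).+1 + t))) ->
  (~~ beval s b -> wp c2 s (fun t => Q ((bcost b).+1 + t))) ->
  wp (If b c1 c2) s Q.
Proof.
move=> H1 H2; case: (boolP (beval s b)) => Hb.
  have [t [s' [e ?]]] := H1 Hb.
  by exists ((bcost b).+1 + t), s'; split=> //; exact: ExecIfT.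
have [t [s' [e ?]]] := H2 Hb.
by exists ((bcost b).+1 + t), s'; split=> //; exact: ExecIfF.
Qed.

(* Amortized cost: an iteration is paid for by the decrease of [phi]. *)
Lemma wp_while (Inv : memory R -> Prop) (phi : memory R -> nat) b c s Q :
  Inv s ->
  (forall s1, Inv s1 -> beval s1 b ->
     wp c s1 (fun t s2 => Inv s2 /\ (bcost b).+1 + t + phi s2 <= phi s1)) ->
  (forall s1, Inv s1 -> ~~ beval s1 b ->
     bcost b < phi s1 /\ forall t, t <= phi s -> Q t s1) ->
  wp (While b c) s Q.
Proof.
move=> Is body exit.
suff [t [s' [e [tle [Is' nb]]]]] : exists t s',
    exec (While b c) s t s' /\ t <= phi s /\ Inv s' /\ ~~ beval s' b.
  by exists t, s'; split=> //; have [_] := exit s' Is' nb; apply.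
have {exit} exit s1 Is1 nb := proj1 (exit s1 Is1 nb).
(* Every iteration pays at least for its test, so [phi] strictly decreases; induction on a bound for
   it gives termination and the time bound together. *)
have [k] := ubnP (phi s); elim: k s Is => // k IH s Is kle.
have [Hb|Hb] := boolP (beval s b); last first.
  by exists (bcost b).+1, s; split; [exact: ExecWhileF|rewrite exit].
have [t1 [s1 [e1 [Is1 le1]]]] := body s Is Hb.
have [|t2 [s2 [e2 [le2 ?]]]] := IH s1 Is1; first by lia.
exists ((bcost b).+1 + t1 + t2), s2; split; first exact: ExecWhileT e1 e2.
by split=> //; lia.
Qed.

End Runs.

Lemma eqbF x y : x <> y -> String.eqb x y = false.
Proof. by move/String.eqb_neq. Qed.

Arguments upd _ _ _ _ _ /.
Arguments upd_at _ _ _ _ _ _ _ /.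

(* Matching on the syntax keeps [apply] from unfolding the named programs. *)
Ltac wp_step :=
  lazymatch goal with
  | |- wp (Seq _ _) _ _ => apply: wp_seq
  | |- wp Skip _ _ => apply: wp_skip
  | |- wp (ISet _ _) _ _ => apply: wp_iset
  | |- wp (RSet _ _) _ _ => apply: wp_rset
  | |- wp (ISetAt _ _ _) _ _ => apply: wp_isetat
  | |- wp (RSetAt _ _ _) _ _ => apply: wp_rsetat
  end.
Ltac wp_steps := repeat wp_step.

(** * Invariants, initialization and queue search *)

Section Procedures.
Variable R : realType.
Implicit Types s : memory R.
Local Open Scope string_scope.
Local Open Scope nat_scope.

(** The step of the code [q] is [q %/ 4], and the codes of states are 4, .., 4n+3. The undefined
    predecessor 0 has step 0, so an empty map qualifies. *)
Definition lower_pred n s : Prop :=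
  forall q, 4 <= q < 4 * n + 4 -> iarr s "P" q %/ 4 < q %/ 4.

Definition queue_clear p s : Prop :=
  forall q, 4 <= q < p -> iarr s "Q" q = 0.

Definition same_ints_but x s s' : Prop :=
  iarr s' = iarr s /\ forall x', x' <> x -> ivar s' x' = ivar s x'.

Lemma wp_Initialize n s : ivar s "n" = n ->
  wp Initialize s (fun t s' =>
    [/\ t <= 200 * n + 20, ivar s' "n" = n & lower_pred n s']).
Proof.
move=> sn; rewrite /Initialize; wp_steps.
apply: (wp_while
  (Inv := fun s1 => [/\ ivar s1 "n" = n, 0 < ivar s1 "j" &
     forall q, 4 <= q < 4 * ivar s1 "j" -> iarr s1 "P" q = 0])
  (phi := fun s1 => 200 * (n.+1 - ivar s1 "j") + 4)).
- by split=> //= q; lia.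
- move=> s1 [/= s1n j0 s1P] jn; wp_steps.
  apply: (wp_while
    (Inv := fun s2 => [/\ ivar s2 "n" = n, ivar s2 "j" = ivar s1 "j",
       ivar s2 "k" <= 4 &
       forall q, 4 <= q < 4 * ivar s1 "j" + ivar s2 "k" -> iarr s2 "P" q = 0])
    (phi := fun s2 => 30 * (4 - ivar s2 "k") + 4)).
  + by split=> //= q ?; apply: s1P; lia.
  + move=> s2 [/= s2n s2j _ s2P] k4; wp_steps => /=.
    split; last by lia.
    split=> //=; first by lia.
    move=> q qle /=; case: eqP => // qne.
    by apply: s2P; move: qne qle; rewrite /= s2j; lia.
  + move=> s2 [/= s2n s2j kle s2P] k4; split; first by lia.
    move=> t tle; wp_steps => /=; move: tle; rewrite /= s2j => tle.
    split; last by lia.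
    by split=> //; [lia|] => q qle; apply: s2P; lia.
- move=> s1 [/= s1n j0 s1P] jn; split; first by lia.
  move=> t tle; wp_steps => /=; split=> //.
    by move: tle; lia.
  by move=> q qle /=; rewrite s1P; lia.
Qed.

Lemma wp_FindLowest n s : ivar s "n" = n ->
  wp FindLowest s (fun t s' =>
    [/\ t <= 80 * n + 60, same_ints_but "p" s s', queue_clear (ivar s' "p") s',
        4 <= ivar s' "p" &
        ivar s' "p" < 4 * n + 4 -> iarr s' "Q" (ivar s' "p") <> 0]).
Proof.
move=> sn; rewrite /FindLowest; wp_steps.
apply: (wp_while
  (Inv := fun s1 => [/\ same_ints_but "p" s s1, queue_clear (ivar s1 "p") s1 &
     4 <= ivar s1 "p"])
  (phi := fun s1 => 20 * (4 * n + 4 - ivar s1 "p") + 13)).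
- split=> //=; last by move=> q /=; lia.
  by split=> //= x; move/eqbF=> ->.
- move=> s1 [[sQ sv] qc p4] /= /andP[plt /eqP Qp].
  have s1n : ivar s1 "n" = n by rewrite sv.
  wp_steps => /=; split; last by lia.
  split=> /=; last by lia.
    by split=> //= x xp; rewrite eqbF ?sv.
  move=> q /= qle.
  (* The only new cell is [p] itself, which the loop test has just found empty. *)
  by have [->//|qne] := eqVneq q (ivar s1 "p"); apply: qc; lia.
- move=> s1 [[sQ sv] qc p4] /= nb; have s1n : ivar s1 "n" = n by rewrite sv.
  split; first by lia.
  move=> t /= tle; split=> //; first by lia.
  by move=> plt Q0; move: nb; rewrite s1n plt Q0.
Qed.

(** * Moves out of an extracted state [p] *)

Definition expanding n p s : Prop :=
  [/\ ivar s "n" = n, ivar s "p" = p, queue_clear p.+1 s & lower_pred n s].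

(** Targets have codes [4 * (m + 1) + k], of step [m + 1 > p %/ 4]. So an insertion leaves the queue
    clear up to and including [p], and the recorded predecessor [p] has a lower step. *)
Lemma wp_Expand n p s : expanding n p s -> p %/ 4 <= ivar s "m" ->
  wp Expand s (fun t s' =>
    [/\ t <= 1300, expanding n p s', ivar s' "m" = ivar s "m" &
        ivar s' "j" = ivar s "j"]).
Proof.
move=> Es pm; rewrite /Expand; wp_steps.
apply: (wp_while
  (Inv := fun s1 => [/\ expanding n p s1, ivar s1 "m" = ivar s "m" &
        ivar s1 "j" = ivar s "j"])
  (phi := fun s1 => 300 * (4 - ivar s1 "k") + 4)).
- by case: Es.
- move=> s1 [[s1n s1p s1Q s1P] s1m s1j] /= k4; wp_steps.
  apply: (wp_while
    (Inv := fun s2 => [/\ iarr s2 = iarr s1, rarr s2 = rarr s1,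
       rvar s2 "v" = rarr s1 "W" (4 * (ivar s1 "m" + 1) + ivar s1 "k"),
       ivar s2 "l" <= ivar s1 "k" &
       [/\ ivar s2 "q" = 4 * (ivar s1 "m" + 1) + ivar s1 "k"
         & forall x, x <> "l" -> x <> "q" -> ivar s2 x = ivar s1 x]])
    (phi := fun s2 => 20 * (ivar s1 "k" - ivar s2 "l") + 20)).
  + split=> //=; split=> // x xl xq; rewrite !eqbF //.
  + move=> s2 [s2a s2r s2v lk [s2q s2x]] /= ne.
    (* The search for the first slot containing [v] stops at [l = k] at the latest, since [v] was
       read from slot [k]. *)
    have {}lk : ivar s2 "l" < ivar s1 "k".
      rewrite ltn_neqAle lk andbT; apply: contra ne => /eqP ->.
      by rewrite s2r s2v s2x.
    wp_steps => /=; split; last by lia.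
    split=> //=; first by lia.
    split=> // x xl xq; rewrite eqbF ?s2x //.
  + move=> s2 [s2a s2r s2v lk [s2q s2x]] _; split=> /=; first by lia.
    move=> t /= tle.
    have [[s2n s2p] s2k [s2m s2j]] : [/\ ivar s2 "n" = n /\ ivar s2 "p" = p,
        ivar s2 "k" = ivar s1 "k" & ivar s2 "m" = ivar s1 "m"
        /\ ivar s2 "j" = ivar s1 "j"] by rewrite !s2x.
    (* All outcomes at once: insertion, improvement or no change alter [P] and [Q] at most in cell
       [q]. *)
    have kept s3 : ivar s3 "n" = n -> ivar s3 "p" = p ->
        iarr s3 "P" = iarr s2 "P" \/
        iarr s3 "P" = upd_at (iarr s2) "P" (ivar s2 "q") (ivar s2 "p") "P" ->
        iarr s3 "Q" = iarr s2 "Q" \/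
        iarr s3 "Q" = upd_at (iarr s2) "Q" (ivar s2 "q") 1 "Q" ->
        ivar s3 "m" = ivar s1 "m" -> ivar s3 "j" = ivar s1 "j" ->
        [/\ expanding n p s3, ivar s3 "m" = ivar s "m"
          & ivar s3 "j" = ivar s "j"].
      move=> s3n s3p s3P s3Q s3m s3j; split; [split=> //|lia|lia].
        move=> q qle; case: s3Q => -> /=; last case: eqP => [qe|_] /=.
        + by rewrite s2a; apply: s1Q.
        + by move: qe; rewrite s2q s1m; lia.
        + by rewrite s2a; apply: s1Q.
      move=> q qle; case: s3P => -> /=; last case: eqP => [qe|_] /=.
      + by rewrite s2a; apply: s1P.
      + by rewrite s2p qe s2q s1m; lia.
      + by rewrite s2a; apply: s1P.
    wp_steps; apply: wp_if => _; wp_steps; [apply: wp_if => _; wp_steps|];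
      [|apply: wp_if => _; wp_steps|];
      (split; [apply: kept => //=; by [left|right] | by rewrite /= s2k; lia]).
- move=> s1 [Es1 s1m s1j] /= k4; split=> /=; first by lia.
  by move=> t tle; split=> //; lia.
Qed.

Lemma wp_SingleStepMoves n p s : expanding n p s -> ivar s "j" = p %/ 4 ->
  wp SingleStepMoves s (fun t s' =>
    [/\ t <= 1400, expanding n p s' & ivar s' "j" = p %/ 4]).
Proof.
move=> Es sj; rewrite /SingleStepMoves; apply: wp_if => _; wp_steps;
  last by split=> //=; case: Es.
apply: wp_mono.
  by apply: (wp_Expand (n := n) (p := p)); [case: Es|rewrite /= sj].
by move=> t s' /= [tle Es' s'm s'j]; split=> //; [lia|rewrite s'j].
Qed.

(** Each pass raises [m], which the guard keeps below [n], and calls [Expand] at most once, at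
    bounded cost. *)
Lemma wp_NullForceMoves n p s : expanding n p s -> ivar s "j" = p %/ 4 ->
  wp NullForceMoves s (fun t s' => t <= 1500 * n + 100 /\ expanding n p s').
Proof.
move=> Es sj; rewrite /NullForceMoves; wp_steps.
apply: (wp_while
  (Inv := fun s1 => expanding n p s1 /\ p %/ 4 <= ivar s1 "m")
  (phi := fun s1 => 1500 * (n - ivar s1 "m") + 50)).
- by rewrite /= sj; split=> //; case: Es.
- move=> s1 [Es1 pm] /= /andP[mn _]; wp_step.
  have [s1n _ _ _] := Es1.
  apply: wp_if => _.
    apply: (wp_mono (wp_Expand Es1 pm)) => t s2 [tle Es2 s2m _]; wp_steps => /=.
    by rewrite s2m; split; last lia; split; [case: Es2|lia].
  by wp_steps => /=; split; last lia; split; [case: Es1|lia].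
- move=> s1 [Es1 _] _; split=> /=; first by lia.
  by move=> t tle; split=> //; lia.
Qed.

(** * The two complete procedures *)

Lemma wp_DynProg n s : ivar s "n" = n -> 0 < n ->
  wp DynProg s (fun t s' =>
    [/\ t <= 20 * 1000 * n ^ 2, ivar s' "n" = n & lower_pred n s']).
Proof.
move=> sn n0; rewrite /DynProg; wp_step.
apply: (wp_mono (wp_Initialize sn)) => t1 s1 [t1le s1n s1P]; wp_steps.
apply: (wp_mono (wp_FindLowest s1n)) => t2 s2 [t2le [s2a s2v] s2Q s2p Qp].
wp_steps.
apply: (wp_while
  (Inv := fun s3 => [/\ ivar s3 "n" = n, lower_pred n s3,
     queue_clear (ivar s3 "p") s3, 4 <= ivar s3 "p" &
     ivar s3 "p" < 4 * n + 4 -> iarr s3 "Q" (ivar s3 "p") <> 0])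
  (* One extraction, with its moves and the next search, costs at most [4000 * n]; the 10 covers the
     final test. *)
  (phi := fun s3 => 4000 * n * (4 * n + 4 - ivar s3 "p") + 10)).
- split=> //=; first by rewrite s2v.
  by move=> q; rewrite s2a /=; exact: s1P.
- move=> {s2 s2a s2v s2Q s2p Qp} s2 [s2n s2P s2Q s2p Qp] /= plt; wp_steps.
  set s3 := set_rvar _ _ _; set p := ivar s2 "p".
  have Es3 : expanding n p s3.
    split=> //= q qle /=; case: eqP => [//|qp /=].
    by apply: s2Q; rewrite -/p; lia.
  have s3j : ivar s3 "j" = p %/ 4 by [].
  apply: (wp_mono (wp_SingleStepMoves Es3 s3j)) => t4 s4 [t4le Es4 s4j].
  wp_step.
  apply: (wp_mono (wp_NullForceMoves Es4 s4j)) => t5 s5.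
  move=> [t5le [s5n s5p s5Q s5P]].
  apply: (wp_mono (wp_FindLowest s5n)) => t6 s6 [t6le [s6a s6v] s6Q s6p Qp6].
  (* The queue is still clear up to [p], while the cell just found is occupied, so it lies beyond
     [p]. *)
  have pp6 : p < ivar s6 "p".
    rewrite ltnNge; apply/negP => p6p; apply: Qp6; first by lia.
    by rewrite s6a; apply: s5Q; lia.
  split; last first.
    have : 4000 * n * (4 * n + 4 - ivar s6 "p").+1
      <= 4000 * n * (4 * n + 4 - p) by apply: leq_mul => //; lia.
    by rewrite mulnSr /=; lia.
  by split=> //; [rewrite s6v|move=> q; rewrite s6a; apply: s5P].
- move=> {s2a s2v s2Q Qp} s3 [s3n s3P _ _ _] _.
  split; first by rewrite ltn_addl.
  move=> t tle; wp_steps; split=> //=.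
  (* Since [4 <= p] at the start, the loop takes at most [16000 * n ^ 2 + 10]; the linear costs
     outside it fit in the remaining [4000 * n ^ 2]. *)
  have : 4000 * n * (4 * n + 4 - ivar s2 "p") <= 4000 * n * (4 * n)
    by apply: leq_mul => //; lia.
  have : n <= n * n by rewrite leq_pmulr.
  by rewrite -mulnn mulnCA mulnA; lia.
Qed.

(** An outer pass goes from step [j] down to [i < j] and costs at most 50 per step between them plus
    a constant. The drop [100 * (j - i)] of the potential pays for both, and these drops
    telescope. *)
Lemma wp_BuildSolution n s : ivar s "n" = n -> 0 < n -> lower_pred n s ->
  wp BuildSolution s (fun t _ => t <= 200 * n).
Proof.
move=> sn n0 sP; rewrite /BuildSolution; wp_steps.
apply: (wp_while
  (* If (n, w_fin) was not reached, its predecessor is 0, whose step 0 ends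
     the loop: hence the first alternative. *)
  (Inv := fun s1 => lower_pred n s1 /\
     [\/ ivar s1 "j" <= 1
       | [/\ ivar s1 "j" = ivar s1 "p" %/ 4 & ivar s1 "p" < 4 * n + 4]])
  (phi := fun s1 => 100 * ivar s1 "j" + 10)).
- by split=> //=; right; lia.
- move=> s1 [s1P [|[s1j pn]]] /= j1; first by lia.
  (* From [1 < j = p %/ 4] the code [p] is at least 8, hence that of a state. *)
  have pb := s1P (ivar s1 "p") ltac:(lia).
  wp_steps.
  apply: (wp_while
    (Inv := fun s2 => [/\ iarr s2 = iarr s1, ivar s2 "j" = ivar s1 "j",
       ivar s2 "b" = iarr s1 "P" (ivar s1 "p"),
       ivar s2 "i" = ivar s2 "b" %/ 4 &
       ivar s2 "i" <= ivar s2 "m" < ivar s2 "j"])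
    (phi := fun s2 => 50 * (ivar s2 "j" - ivar s2 "m") + 10)).
  + by split=> //=; lia.
  + move=> s2 [s2a s2j s2b s2i im] /= mj; wp_steps => /=.
    by split; [split=> //; lia|lia].
  + move=> s2 [s2a s2j s2b s2i im] _ /=; split; first by lia.
    move=> t tle; wp_steps => /=; split; last by lia.
    split; first by move=> q /=; rewrite s2a; apply: s1P.
    by right; split=> //; lia.
- move=> s1 _ _; split=> /=; first by lia.
  by move=> t tle; rewrite sn in tle; lia.
Qed.

End Procedures.

Theorem proposition6p2 (R : realType) :
  (exists C : nat,
     forall (n : nat) (D : problem R n) (s : memory R),
       3 <= n -> loaded D s ->
       halts_within DynProg s (C * n ^ 2))
  /\
  (exists C : nat,
     forall (n : nat) (D : problem R n) (s s1 : memory R) (t : nat),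
       3 <= n -> loaded D s -> exec DynProg s t s1 ->
       halts_within BuildSolution s1 (C * n)).
Proof.
split.
  exists (20 * 1000) => n D s n3 Ds.
  have [t [s' [e [tle _ _]]]] := wp_DynProg (ld_n Ds) (ltnW (ltnW n3)).
  by exists t, s'.
exists 200 => n D s s1 t n3 Ds e.
have [t' [s' [e' [_ s'n s'P]]]] := wp_DynProg (ld_n Ds) (ltnW (ltnW n3)).
(* Determinism identifies the given final memory [s1] with the one known to satisfy [lower_pred]. *)
have [_ ->] := exec_det e e'.
have [t2 [s2 [e2 tle]]] := wp_BuildSolution s'n (ltnW (ltnW n3)) s'P.
by exists t2, s2.
Qed.
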